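(* Even if the chase of a rule set $\mathcal{R}$ terminates, the chase of every TGD set in $\mathsf{Sing}(\mathcal{R})$ may not.
   Context: Rules are function- and constant-free first-order formulas of two kinds: tuple generating dependencies (TGDs) $\forall \vec{x},\vec{y}.(\beta[\vec{x},\vec{y}] \to \exists \vec{w}.\eta[\vec{x},\vec{w}])$ and equality generating dependencies (EGDs) $\forall \vec{x}.(\beta[\vec{x}] \to x \approx y)$ with $x,y \in \vec{x}$, where $\beta,\eta$ are non-empty conjunctions of equality-free atoms. The (non-oblivious, Skolem) chase on an ontology $\langle\mathcal{R},\mathcal{F}\rangle$ starts from the fact set $\mathcal{F}$; a TGD with body match $\sigma$ is applicable if no extension of $\sigma$ maps its head into the current set and then adds its head with existential variables $w$ replaced by Skolem terms $f_w(\sigma(\vec{x}))$; an EGD with body match $\sigma$ and $\sigma(x)\neq\sigma(y)$ merges the two terms (deeper into shallower by a fixed total order compatible with depth). Chase sequences must be fair. The chase of a rule set $\mathcal{R}$ terminates if for every fact set $\mathcal{F}$ all chase sequences of $\langle\mathcal{R},\mathcal{F}\rangle$ are finite. A singularisation of a conjunction of atoms $\beta$ is obtained by choosing, for each variable $x$ of $\beta$, one of its occurrences to keep, replacing every other ($i$-th) occurrence of $x$ by a fresh variable $x_i$, and adding the atom $\mathsf{EQ}(x,x_i)$ for each such fresh variable, where $\mathsf{EQ}$ is a fresh binary predicate. A singularisation of a TGD $\beta\to\exists\vec{w}.\eta$ is $\beta'\to\exists\vec{w}.\eta$ and of an EGD $\beta\to x\approx y$ is $\beta'\to\mathsf{EQ}(x,y)$,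 with $\beta'$ a singularisation of $\beta$. $\mathsf{Sing}(\mathcal{R})$ is the set of all TGD sets containing exactly one singularisation of each rule of $\mathcal{R}$, together with the reflexivity rules $P(x_1,\ldots,x_n)\to\bigwedge_i\mathsf{EQ}(x_i,x_i)$ for every predicate $P\neq\approx$ of $\mathcal{R}$, symmetry $\mathsf{EQ}(x,y)\to\mathsf{EQ}(y,x)$, and transitivity $\mathsf{EQ}(x,y)\wedge\mathsf{EQ}(y,z)\to\mathsf{EQ}(x,z)$. The claim means: there is a rule set whose chase terminates while the chase of no TGD set in $\mathsf{Sing}(\mathcal{R})$ terminates. *)

(* Defs.v *)
From HB Require Import structures.
From mathcomp Require Import all_boot finmap.

Set Implicit Arguments.
Unset Strict Implicit.
Unset Printing Implicit Defensive.

Local Open Scope fset_scope.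

(* The predicate (n, k) is the n-th predicate of arity k + 1: there are
   infinitely many predicates of every arity >= 1. *)
Definition predicate := (nat * nat)%type.
Definition arity (p : predicate) : nat := p.2.+1.

Definition var := nat.

(* An atom over T is a predicate with its argument list; the match between arity
   and number of arguments is imposed by wf_atom. *)
Definition atom (T : Type) := (predicate * seq T)%type.
Definition wf_atom (T : Type) (a : atom T) : bool := size a.2 == arity a.1.

(* A conjunction of atoms, without the equality symbol. *)
Definition conjunction := seq (atom var).
(* All occurrences of variables, from left to right (with repetitions). *)
Definition vars (c : conjunction) : seq var := flatten (unzip2 c).
Definition wf_conjunction (c : conjunction) : bool :=
  (c != [::]) && all (@wf_atom var) c.

(* A TGD beta[x, y] -> exists w, eta[x, w] is given by its body and its head: x is
   the list of the variables common to both, w that of the variables of the head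
   that do not occur in the body. *)
Record tgd := Tgd { tgd_body : conjunction; tgd_head : conjunction }.
Definition tgd_pair (t : tgd) := (tgd_body t, tgd_head t).
Definition pair_tgd (p : conjunction * conjunction) := Tgd p.1 p.2.
Lemma tgd_pairK : cancel tgd_pair pair_tgd. Proof. by case. Qed.
HB.instance Definition _ := Countable.copy tgd (can_type tgd_pairK).

Record egd := Egd { egd_body : conjunction; egd_lhs : var; egd_rhs : var }.
Definition egd_pair (e : egd) := (egd_body e, (egd_lhs e, egd_rhs e)).
Definition pair_egd (p : conjunction * (var * var)) := Egd p.1 p.2.1 p.2.2.
Lemma egd_pairK : cancel egd_pair pair_egd. Proof. by case. Qed.
HB.instance Definition _ := Countable.copy egd (can_type egd_pairK).

Inductive rule := TGD of tgd | EGD of egd.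
Definition rule_sum (r : rule) : tgd + egd :=
  match r with TGD t => inl t | EGD e => inr e end.
Definition sum_rule (s : tgd + egd) : rule :=
  match s with inl t => TGD t | inr e => EGD e end.
Lemma rule_sumK : cancel rule_sum sum_rule. Proof. by case. Qed.
HB.instance Definition _ := Countable.copy rule (can_type rule_sumK).

Definition wf_rule (r : rule) : bool :=
  match r with
  | TGD t => wf_conjunction (tgd_body t) && wf_conjunction (tgd_head t)
  | EGD e => [&& wf_conjunction (egd_body e), egd_lhs e \in vars (egd_body e)
                & egd_rhs e \in vars (egd_body e)]
  end.
Definition wf_rules (R : {fset rule}) : Prop := forall r, r \in R -> wf_rule r.

Definition rule_preds (r : rule) : seq predicate :=
  match r with
  | TGD t => unzip1 (tgd_body t) ++ unzip1 (tgd_head t)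
  | EGD e => unzip1 (egd_body e)
  end.
Definition preds (R : {fset rule}) : seq predicate :=
  flatten [seq rule_preds r | r <- enum_fset R].

(* Ground terms. The Skolem function f_w of an existential variable w of a TGD t is
   the symbol (t, w), so that distinct rules never share a Skolem function. *)
Inductive term :=
  | Cst of nat
  | Sk of tgd & var & seq term.

Fixpoint encode_term (t : term) : GenTree.tree (nat + tgd * var) :=
  match t with
  | Cst n => GenTree.Leaf (inl n)
  | Sk r w ts => GenTree.Node 0 (GenTree.Leaf (inr (r, w)) :: map encode_term ts)
  end.
Fixpoint decode_term (t : GenTree.tree (nat + tgd * var)) : term :=
  match t with
  | GenTree.Node _ (GenTree.Leaf (inr (r, w)) :: ts) => Sk r w (map decode_term ts)
  | GenTree.Leaf (inl n) => Cst n
  | _ => Cst 0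
  end.
Lemma encode_termK : cancel encode_term decode_term.
Proof.
rewrite /cancel; fix IH 1; case=> [n|r w ts] //=; congr (Sk r w _).
by elim: ts => [|t ts IHts] //=; rewrite IH IHts.
Qed.
HB.instance Definition _ := Countable.copy term (can_type encode_termK).

Fixpoint depth (t : term) : nat :=
  match t with
  | Cst _ => 0
  | Sk _ _ ts => (foldr maxn 0 (map depth ts)).+1
  end.

Definition depth_order (le : rel term) : Prop :=
  [/\ total le, antisymmetric le, transitive le
    & forall t u, depth t < depth u -> le t u].

Definition fact := atom term.

Definition is_cst (t : term) : bool := if t is Cst _ then true else false.
(* The fact sets from which a chase may start: finite, and without Skolem terms. *)
Definition input_facts (F : {fset fact}) : Prop :=
  forall a, a \in F -> wf_atom a && all is_cst a.2.

(* Only the values on the variables of the formula at hand are relevant. *)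
Definition substitution := var -> term.
Definition subst_atom (s : substitution) (a : atom var) : fact := (a.1, map s a.2).
Definition maps_into (s : substitution) (c : conjunction) (F : {fset fact}) : Prop :=
  forall a, a \in c -> subst_atom s a \in F.

Definition applicable (r : rule) (s : substitution) (F : {fset fact}) : Prop :=
  match r with
  | TGD t => maps_into s (tgd_body t) F /\
      ~ (exists s' : substitution,
           (forall x, x \in vars (tgd_body t) -> s' x = s x) /\
           maps_into s' (tgd_head t) F)
  | EGD e => maps_into s (egd_body e) F /\ s (egd_lhs e) <> s (egd_rhs e)
  end.

Definition frontier (t : tgd) : seq var :=
  [seq x <- undup (vars (tgd_body t)) | x \in vars (tgd_head t)].
Definition skolem_subst (t : tgd) (s : substitution) : substitution := fun x =>
  if x \in vars (tgd_body t) then s x else Sk t x (map s (frontier t)).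

(* Terms are atomic values as far as merging is concerned: u becomes v wherever u
   is an argument of a fact, not inside other Skolem terms. *)
Definition merge_atom (u v : term) (a : fact) : fact :=
  (a.1, [seq if t == u then v else t | t <- a.2]).
Definition merge_facts (u v : term) (F : {fset fact}) : {fset fact} :=
  [fset merge_atom u v a | a in F].

Definition apply_rule (le : rel term) (r : rule) (s : substitution) (F : {fset fact})
    : {fset fact} :=
  match r with
  | TGD t => F `|` [fset a in [seq subst_atom (skolem_subst t s) b | b <- tgd_head t]]
  | EGD e => let u := s (egd_lhs e) in let v := s (egd_rhs e) in
             if le u v then merge_facts v u F else merge_facts u v F
  end.

(* A finite or infinite sequence F_0, F_1, ... is a function that is constantly None
   after the end of the sequence. *)
Record chase_sequence (le : rel term) (R : {fset rule}) (F : {fset fact})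
    (S : nat -> option {fset fact}) : Prop := ChaseSequence {
  chase_start : S 0 = Some F;
  chase_end : forall i, S i = None -> S i.+1 = None;
  chase_step : forall i G H, S i = Some G -> S i.+1 = Some H ->
    exists r s, [/\ r \in R, applicable r s G & H = apply_rule le r s G];
  (* In particular, no rule is applicable to the last set of a finite sequence. *)
  chase_fair : forall i G r s, S i = Some G -> r \in R -> applicable r s G ->
    exists j H, [/\ i < j, S j = Some H & ~ applicable r s H]
}.

Definition terminates (le : rel term) (R : {fset rule}) : Prop :=
  forall F, input_facts F ->
  forall S, chase_sequence le R F S -> exists i, S i = None.

(* The singularisation of c that keeps the occurrence number keep x of each variable
   x and puts the variable fresh k in place of any other occurrence number k;
   occurrences are numbered from 0, from left to right, in vars c. *)
Definition sing_conj (EQ : predicate) (keep : var -> nat) (fresh : nat -> var)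
    (c : conjunction) : conjunction :=
  let vs := vars c in
  let old k := nth 0 vs k in
  let new k := if k == keep (old k) then old k else fresh k in
  zip (unzip1 c) (reshape (shape (unzip2 c)) (mkseq new (size vs))) ++
  [seq (EQ, [:: old k; fresh k]) | k <- iota 0 (size vs) & k != keep (old k)].

(* avoid lists the variables of the rule whose body is c. *)
Definition is_sing_conj (EQ : predicate) (avoid : seq var) (c c' : conjunction)
    : Prop :=
  exists (keep : var -> nat) (fresh : nat -> var),
    [/\ forall x, x \in vars c ->
          keep x < size (vars c) /\ nth 0 (vars c) (keep x) = x,
        injective fresh,
        forall k, fresh k \notin avoid
      & c' = sing_conj EQ keep fresh c].

Definition is_sing_rule (EQ : predicate) (r : rule) (t : tgd) : Prop :=
  match r with
  | TGD t0 => is_sing_conj EQ (vars (tgd_body t0) ++ vars (tgd_head t0))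
                (tgd_body t0) (tgd_body t)
              /\ tgd_head t = tgd_head t0
  | EGD e => is_sing_conj EQ (vars (egd_body e)) (egd_body e) (tgd_body t)
             /\ tgd_head t = [:: (EQ, [:: egd_lhs e; egd_rhs e])]
  end.

Definition refl_rule (EQ P : predicate) : tgd :=
  Tgd [:: (P, iota 0 (arity P))] [seq (EQ, [:: i; i]) | i <- iota 0 (arity P)].
Definition sym_rule (EQ : predicate) : tgd :=
  Tgd [:: (EQ, [:: 0; 1])] [:: (EQ, [:: 1; 0])].
Definition trans_rule (EQ : predicate) : tgd :=
  Tgd [:: (EQ, [:: 0; 1]); (EQ, [:: 1; 2])] [:: (EQ, [:: 0; 2])].

(* T belongs to Sing(R), up to the names of the fresh variables. *)
Definition Sing (EQ : predicate) (R : {fset rule}) (T : {fset tgd}) : Prop :=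
  exists g : rule -> tgd,
    (forall r, r \in R -> is_sing_rule EQ r (g r)) /\
    T = [fset g r | r in R]
        `|` [fset t in [seq refl_rule EQ P | P <- preds R]]
        `|` [fset sym_rule EQ; trans_rule EQ].

Definition tgd_rules (T : {fset tgd}) : {fset rule} := [fset TGD t | t in T].

(* Main.v *)
(** Let R consist of the EGD [S(x,y) -> x = y] and of the TGD
    [S(x,x) -> exists w v, S(x,w) /\ S(v,x)].  The TGD is a tautology, hence never
    applicable, and each application of the EGD removes a term: every chase is
    finite.  In a singularisation the body of the TGD becomes [S(x,z), EQ(x,z)] or
    [S(z,x), EQ(x,z)], and the atom [EQ(x,z)] comes for free from the singularised
    EGD and symmetry: so every source of an S-edge (resp. every target) must have S-edges in both
    directions.  Starting from the single edge [S(0,1)], the edge entering 0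
    (resp. leaving 1) can only be one to a new Skolem term, which is in turn the
    source (resp. target) of an edge, and so on: no finite set is reached at which
    no rule is applicable, and a fair chase sequence is infinite. *)

Require Import Defs.
From mathcomp Require Import all_boot finmap.
From mathcomp Require Import boolp.

Set Implicit Arguments.
Unset Strict Implicit.
Unset Printing Implicit Defensive.

Local Open Scope fset_scope.

(** * Terms of a fact set and the effect of merging *)

Definition terms (G : {fset fact}) : {fset term} :=
  [fset t in flatten [seq a.2 | a <- G]].

Lemma termsP (G : {fset fact}) (t : term) :
  reflect (exists2 a, a \in G & t \in a.2) (t \in terms G).
Proof.
rewrite inE; apply: (iffP flatten_mapP) => -[a aG ta]; by exists a.
Qed.

Lemma terms_merge (u v : term) (G : {fset fact}) :
  u != v -> u \in terms G -> v \in terms G ->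
  #|` terms (merge_facts u v G)| < #|` terms G|.
Proof.
move=> uv uG vG; apply: (@leq_ltn_trans #|` terms G `\ u|); last first.
  by rewrite [leqRHS](cardfsD1 u) uG.
apply/fsubset_leq_card/fsubsetP => t /termsP[a /imfsetP[/= b bG ->]] /=.
case/mapP=> t' t'b ->; rewrite in_fsetD1; case: ifPn => [_|->] /=.
  by rewrite eq_sym uv.
by apply/termsP; exists b.
Qed.

(** * Existence of fair chase sequences for TGD sets *)

Section FairChase.
Variables (le : rel term) (T : {fset tgd}).

Definition satisfied (t : tgd) (s : substitution) (G : {fset fact}) : Prop :=
  exists s' : substitution,
    (forall x, x \in vars (tgd_body t) -> s' x = s x) /\
    maps_into s' (tgd_head t) G.

Lemma maps_intoS s c (G H : {fset fact}) :
  G `<=` H -> maps_into s c G -> maps_into s c H.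
Proof. by move=> /fsubsetP GH sc a /sc/GH. Qed.

Lemma satisfiedS t s (G H : {fset fact}) :
  G `<=` H -> satisfied t s G -> satisfied t s H.
Proof. by move=> GH [s' [s's /(maps_intoS GH)]]; exists s'. Qed.

Lemma apply_tgdS t s (G : {fset fact}) : G `<=` apply_rule le (TGD t) s G.
Proof. exact: fsubsetUl. Qed.

Lemma satisfied_apply t s (G : {fset fact}) :
  satisfied t s (apply_rule le (TGD t) s G).
Proof.
exists (skolem_subst t s); split=> [x xt|b bt]; first by rewrite /skolem_subst xt.
by rewrite /= inE; apply/orP; right; rewrite inE; apply/mapP; exists b.
Qed.

Lemma mem_vars c (a : atom var) x : a \in c -> x \in a.2 -> x \in vars c.
Proof. by move=> ac xa; apply/flattenP; exists a.2; rewrite ?map_f. Qed.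

Lemma eq_maps_into s s' c (G : {fset fact}) :
  {in vars c, s =1 s'} -> maps_into s c G -> maps_into s' c G.
Proof.
move=> ss' sc a ac.
rewrite -(_ : subst_atom s a = subst_atom s' a); first exact: sc.
by congr pair; apply/eq_in_map => x xa; apply/ss'/(mem_vars ac).
Qed.

Lemma eq_applicable t s s' (G : {fset fact}) :
  {in vars (tgd_body t), s =1 s'} ->
  applicable (TGD t) s G <-> applicable (TGD t) s' G.
Proof.
suff imp u v : {in vars (tgd_body t), u =1 v} ->
    applicable (TGD t) u G -> applicable (TGD t) v G.
  by move=> ss'; split; apply: imp => // x /ss'.
move=> uv [ub nsat]; split; first exact: eq_maps_into ub.
by case=> s1 [s1v s1h]; apply: nsat; exists s1; split=> // x xb; rewrite s1v ?uv.
Qed.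

(* Substitutions are truncated to finite sequences, so that the pairs of a TGD and
   a substitution can be numbered. *)
Definition trigger (n : nat) : option (tgd * substitution) :=
  omap (fun p : tgd * seq term => (p.1, nth (Cst 0) p.2)) (choice.unpickle n).

(** A body has finitely many variables, so cutting [s] off after the largest one changes none of its
    values there. *)
Lemma triggerP (t : tgd) (s : substitution) :
  exists n s', trigger n = Some (t, s') /\ {in vars (tgd_body t), s =1 s'}.
Proof.
pose ts := mkseq s (\max_(x <- vars (tgd_body t)) x).+1.
exists (choice.pickle (t, ts)), (nth (Cst 0) ts); split.
  by rewrite /trigger choice.pickleK.
by move=> x xb; rewrite nth_mkseq // ltnS; apply: leq_bigmax_seq.
Qed.

Definition active (n : nat) (G : {fset fact}) : Prop :=
  exists t s, [/\ trigger n = Some (t, s), t \in T & applicable (TGD t) s G].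

(** Unlike [active], this property never reappears when facts are added, so counting it yields a
    decreasing measure. *)
Definition unsatisfied (n : nat) (G : {fset fact}) : Prop :=
  exists t s, trigger n = Some (t, s) /\ ~ satisfied t s G.

Definition unsatisfied_upto (n : nat) (G : {fset fact}) : nat :=
  count (fun m => asbool (unsatisfied m G)) (iota 0 n.+1).

(** The Skolem terms satisfy trigger [m], and as facts are only added, no satisfied trigger is
    lost. *)
Lemma unsatisfied_upto_apply n m t s (G : {fset fact}) :
    m <= n -> trigger m = Some (t, s) -> ~ satisfied t s G ->
  unsatisfied_upto n (apply_rule le (TGD t) s G) < unsatisfied_upto n G.
Proof.
move=> mn mE nsat; set H := apply_rule _ _ _ _.
rewrite /unsatisfied_upto.
have mN : m \in iota 0 n.+1 by rewrite mem_iota.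
have /permP countE := perm_to_rem mN; rewrite !{}countE /=.
have -> : `[< unsatisfied m G >] by apply/asboolP; exists t, s.
have -> : `[< unsatisfied m H >] = false.
  apply/asboolP => -[t' [s' []]]; rewrite mE => -[<- <-].
  by apply; apply: satisfied_apply.
rewrite add0n add1n ltnS; apply: sub_count => k /asboolP[t' [s' [kE ns]]].
apply/asboolP; exists t', s'; split=> // sat.
by apply/ns/(satisfiedS _ sat)/apply_tgdS.
Qed.

(* The least active trigger is applied at each step. Once applied, a trigger never
   becomes active again, so that each trigger is eventually dealt with. *)
Lemma fair_chase_exists (F : {fset fact}) :
  exists S, chase_sequence le (tgd_rules T) F S.
Proof.
have /choice[next nextP] (G : {fset fact}) : exists o : option {fset fact},
    if o is Some H then
      exists n t s, [/\ trigger n = Some (t, s), t \in T, applicable (TGD t) s G,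
        H = apply_rule le (TGD t) s G & forall m, active m G -> n <= m]
    else forall n, ~ active n G.
  have [exn|nex] := pselect (exists n, `[< active n G >]).
    case: (ex_minnP exn) => n /asboolP[t [s [nE tT app]]] nmin.
    exists (Some (apply_rule le (TGD t) s G)), n, t, s; split=> // m mG.
    by apply: nmin; apply/asboolP.
  by exists None => n nG; apply: nex; exists n; apply/asboolP.
pose S n := iter n (obind next) (Some F).
have SS n G : S n = Some G -> S n.+1 = next G by rewrite /S /= => ->.
exists S; split=> [//|i Si|i G H SiG|i G r s SiG].
- by rewrite /S /= -/(S i) Si.
- rewrite (SS _ _ SiG) => nG; have := nextP G; rewrite nG.
  move=> [n [t [s [_ tT app -> _]]]]; exists (TGD t), s; split=> //.
  exact: in_imfset.
- case/imfsetP=> /= t tT -> {r}; have [n [s' [nE ss']]] := triggerP t s.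
  move=> /(eq_applicable _ ss') app.
  suff [j [H [ij SjH nact]]] :
      exists j H, [/\ i < j, S j = Some H & ~ applicable (TGD t) s' H].
    by exists j, H; split=> // /(eq_applicable _ ss').
  (* While trigger [n] stays active, the trigger applied has an index at most [n], so each step
     lowers this count. *)
  have [k kG] := ubnP (unsatisfied_upto n G).
  elim: k => // k IHk in i G SiG app kG *.
  have nG : active n G by exists t, s'.
  have := nextP G; case nextG: (next G) => [H|]; last by move=> /(_ n).
  move=> [m [t1 [s1 [mE t1T [_ ns1] HE mmin]]]].
  have SiH : S i.+1 = Some H by rewrite (SS _ _ SiG).
  have [appH|nappH] := pselect (applicable (TGD t) s' H); last by exists i.+1, H.
  have Hk : unsatisfied_upto n H < k.
    rewrite -ltnS (leq_trans _ kG) // ltnS HE.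
    exact: unsatisfied_upto_apply (mmin _ nG) mE ns1.
  have [j [K [ij SjK nK]]] := IHk _ _ SiH appH Hk.
  by exists j, K; split=> //; apply: ltnW.
Qed.

End FairChase.

(** * Invariants and last sets of chase sequences *)

Lemma chase_ind le R F S (P : {fset fact} -> Prop) : chase_sequence le R F S ->
    P F ->
    (forall r s G, r \in R -> applicable r s G -> P G -> P (apply_rule le r s G)) ->
  forall i G, S i = Some G -> P G.
Proof.
move=> [S0 Send Sstep _] PF Pstep; elim=> [|i IHi] G; first by rewrite S0 => -[<-].
case Si: (S i) => [H|]; last by rewrite Send.
by move=> /(Sstep _ _ _ Si)[r [s [rR app ->]]]; apply: Pstep => //; apply: IHi.
Qed.

(** Were a rule applicable to the last set, fairness would demand a later one. *)
Lemma chase_last le R F S : chase_sequence le R F S -> (exists i, S i = None) ->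
  exists i G, S i = Some G /\ forall r s, r \in R -> ~ applicable r s G.
Proof.
move=> [S0 Send _ Sfair] [i SiN].
have exN : exists i, S i == None by exists i; apply/eqP.
case: (ex_minnP exN) => -[|{}i] /eqP {}SiN imin; first by rewrite S0 in SiN.
case Si: (S i) => [G|]; last by have := imin i; rewrite Si ltnn => /(_ isT).
exists i, G; split=> // r s rR /(Sfair _ _ _ _ Si rR)[j [H [ij SjH _]]].
suff : S j = None by rewrite SjH.
elim: j ij {SjH} => // j IHj; rewrite ltnS leq_eqVlt => /predU1P[<- //|/IHj].
exact: Send.
Qed.

(** * The rule set and the termination of its chase *)

Definition edge_pred : predicate := (0, 1).

(* The direction d distinguishes the two singularisations of loop_tgd, so that both
   are handled at once: for d = false everything is mirrored. *)
Definition edge (A : Type) (d : bool) (x y : A) : atom A :=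
  (edge_pred, if d then [:: x; y] else [:: y; x]).

Definition loop_tgd : tgd :=
  Tgd [:: edge true 0 0] [:: edge true 0 1; edge true 2 0].
Definition edge_egd : egd := Egd [:: edge true 0 1] 0 1.
Definition loop_rules : {fset rule} := [fset TGD loop_tgd; EGD edge_egd].

Lemma wf_loop_rules : wf_rules loop_rules.
Proof. by move=> r; rewrite !inE => /orP[]/eqP->. Qed.

(** The loop at [s 0] matched by the body serves as the image of both head atoms. *)
Lemma loop_tgd_satisfied s G : ~ applicable (TGD loop_tgd) s G.
Proof.
case=> sG []; exists (fun=> s 0); split=> [x|a].
  by rewrite !inE => /orP[]/eqP->.
by rewrite !inE => /orP[]/eqP->; apply: (sG (edge true 0 0)); rewrite inE.
Qed.

Lemma loop_rules_terminates le : terminates le loop_rules.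
Proof.
move=> F _ S [S0 Send Sstep _].
suff SN n i G : S i = Some G -> #|` terms G| < n -> exists j, S j = None.
  exact: SN S0 (ltnSn _).
elim: n => // n IHn in i G *; move=> Si Gn.
case SiS: (S i.+1) => [H|]; last by exists i.+1.
apply: (IHn _ _ SiS); rewrite -ltnS (leq_trans _ Gn) // ltnS {Gn}.
have [r [s []]] := Sstep _ _ _ Si SiS.
rewrite !inE => /orP[]/eqP->; first by move/loop_tgd_satisfied.
move=> [sG /eqP s01] ->.
have s01G : edge true (s 0) (s 1) \in G.
  by apply: (sG (edge true 0 1)); rewrite inE.
have s0G : s 0 \in terms G.
  by apply/termsP; exists (edge true (s 0) (s 1)); rewrite ?inE ?eqxx.
have s1G : s 1 \in terms G.
  by apply/termsP; exists (edge true (s 0) (s 1)); rewrite ?inE ?eqxx ?orbT.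
by rewrite /=; case: ifP => _; apply: terms_merge; rewrite // eq_sym.
Qed.

(** * Shape of the singularised rules *)

Lemma sing_loop_tgd EQ t : is_sing_rule EQ (TGD loop_tgd) t ->
  exists d f,
    t = Tgd [:: edge d 0 f.+3; (EQ, [:: 0; f.+3])] (tgd_head loop_tgd).
Proof.
case: t => b h /= [[keep [fresh [keepP _ freshP ->]]] ->].
have {keepP} [] := keepP 0 isT; rewrite /sing_conj /=.
(* Fresh variables avoid the variables 0, 1 and 2 of the rule. *)
have freshE k : exists f, fresh k = f.+3.
  by have := freshP k; case: (fresh k) => [|[|[|f]]] // _; exists f.
case: (keep 0) => [|[|//]] _ _.
- by have [f fE] := freshE 1; exists true, f; rewrite /= fE.
- by have [f fE] := freshE 0; exists false, f; rewrite /= fE.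
Qed.

(** Each variable occurs once in the body, so no occurrence is replaced. *)
Lemma sing_edge_egd EQ t : is_sing_rule EQ (EGD edge_egd) t ->
  t = Tgd [:: edge true 0 1] [:: (EQ, [:: 0; 1])].
Proof.
case: t => b h /= [[keep [fresh [keepP _ _ ->]]] ->]; congr Tgd.
have [] := keepP 0 isT; have [] := keepP 1 isT; rewrite /sing_conj /=.
by case: (keep 0) => [|[|//]] //; case: (keep 1) => [|[|//]].
Qed.

(** Without existential variables, any extension of [s] satisfying the head agrees with [s] on
    it. *)
Lemma datalog_closed t s G : {subset vars (tgd_head t) <= vars (tgd_body t)} ->
    ~ applicable (TGD t) s G -> maps_into s (tgd_body t) G ->
  maps_into s (tgd_head t) G.
Proof.
move=> hb napp sb; apply/not_notP => nsh; apply: napp; split=> // -[s' [s's s'h]].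
by apply/nsh/(eq_maps_into _ s'h) => x /hb; apply: s's.
Qed.

(** * Nontermination of every singularisation *)

Lemma sing_loop_nonterminating le EQ (T : {fset tgd}) :
  EQ != edge_pred -> Sing EQ loop_rules T -> ~ terminates le (tgd_rules T).
Proof.
move=> EQ_edge [g [gP TE]].
have [loopR egdR] : TGD loop_tgd \in loop_rules /\ EGD edge_egd \in loop_rules.
  by rewrite !inE !eqxx.
have [d [f tE]] := sing_loop_tgd (gP _ loopR).
have eE := sing_edge_egd (gP _ egdR).
set t := g (TGD loop_tgd) in tE; set e := g (EGD edge_egd) in eE.
have tT : TGD t \in tgd_rules T.
  by apply: in_imfset; rewrite TE !inE (in_imfset _ g) ?loopR.
have eT : TGD e \in tgd_rules T.
  by apply: in_imfset; rewrite TE !inE (in_imfset _ g) ?egdR.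
have symT : TGD (sym_rule EQ) \in tgd_rules T.
  by apply: in_imfset; rewrite TE !inE eqxx !orbT.
(* Only [t] can create edges; all other rules derive [EQ] atoms. *)
have headT u : u \in T -> u = t \/ {in tgd_head u, forall a, a.1 = EQ}.
  rewrite TE !in_fsetU => /orP[/orP[/imfsetP[/= r rR ->]|]|].
  - move: rR; rewrite !inE => /orP[]/eqP->; first by left.
    by right=> a; rewrite -/e eE inE => /eqP->.
  - by rewrite inE => /mapP[P _ ->]; right=> a /mapP[k _ ->].
  - by rewrite !inE => /orP[]/eqP->; right=> a; rewrite inE => /eqP->.
have body_vars : vars (tgd_body t) =i [:: 0; f.+3].
  by move=> x; rewrite tE /=; case: (d); rewrite !inE; do 2!case: eqP.
have sk0 s : skolem_subst t s 0 = s 0 by rewrite /skolem_subst body_vars.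
have skS s k : k \in [:: 1; 2] -> skolem_subst t s k = Sk t k [:: s 0].
  have -> : [:: s 0] = map s (frontier t).
    by rewrite tE /frontier /=; case: (d); rewrite /= !inE !eqxx.
  by rewrite /skolem_subst body_vars !inE => /orP[]/eqP->.
(* The existential variables at the end of the edge leaving 0 and at the start of the edge entering
   0, in direction [d]. *)
pose out := if d then 1 else 2; pose inn := if d then 2 else 1.
pose c (b : bool) := Cst b.
(* For both values of [d] this is the edge from [Cst 0] to [Cst 1]. *)
pose F : {fset fact} := [fset edge d (c (~~ d)) (c d)].
have F_input : input_facts F.
  by move=> a; rewrite inE => /eqP->; rewrite /F; case: (d).
pose inv (G : {fset fact}) := edge d (c (~~ d)) (c d) \in G /\
  forall a b, edge d a b \in G ->
    [\/ b = c d, b = Sk t out [:: a] | a = Sk t inn [:: b]].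
move=> /(_ F F_input) term.
have [S Schase] := fair_chase_exists le T F.
have [i [H [SiH nappH]]] := chase_last Schase (term S Schase).
have [FH invH] : inv H.
  apply: (chase_ind Schase _ _ SiH) => [|r s G /imfsetP[/= u uT ->] _ [FG invG]].
    split=> [|a b]; first by rewrite inE.
    by rewrite inE /edge; case: (d) => /eqP[-> ->]; constructor 1.
  split=> [|a b]; first by rewrite inE FG.
  rewrite /= in_fsetU => /orP[/invG //|]; rewrite inE => /mapP[h hu hE].
  case: (headT _ uT) hu hE => [->|uEQ]; last first.
    by move/uEQ=> hEQ [hE _]; case/eqP: EQ_edge; rewrite -hEQ.
  rewrite {1}tE !inE => /orP[]/eqP->; rewrite /subst_atom /= sk0 skS //.
    by rewrite /edge /out /inn; case: (d) => -[-> ->]; [constructor 2 | constructor 3].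
  by rewrite /edge /out /inn; case: (d) => -[-> ->]; [constructor 3 | constructor 2].
have edge_EQ a b : edge true a b \in H ->
    (EQ, [:: a; b]) \in H /\ (EQ, [:: b; a]) \in H.
  move=> abH.
  pose s (x : var) := if x is 0 then a else b.
  have abEQ : (EQ, [:: a; b]) \in H.
    apply: (@datalog_closed e s H _ (nappH _ s eT) _ (EQ, [:: 0; 1]));
      rewrite eE ?inE //.
    by move=> _ /predU1P[->|//].
  split=> //.
  apply: (@datalog_closed (sym_rule EQ) s H _ (nappH _ s symT) _ (EQ, [:: 1; 0])).
  - by move=> x; rewrite !inE orbC.
  - by move=> _ /predU1P[->|//].
  - by rewrite inE.
have inH a y : edge d a y \in H -> exists z, edge d z a \in H.
  move=> ayH; pose s (x : var) := if x is 0 then a else y.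
  have ayEQ : (EQ, [:: a; y]) \in H.
    by move: ayH; case: (d) => /edge_EQ[].
  have [s' [s's s'h]] : satisfied t s H.
    apply/not_notP => nsat; apply: (nappH _ s tT); split=> // h.
    rewrite tE !inE => /orP[]/eqP-> //; move: ayH.
    by rewrite /edge /subst_atom; case: (d).
  have s'0 : s' 0 = a by rewrite s's // body_vars.
  exists (s' inn); rewrite -s'0 /inn; rewrite tE in s'h.
  by case: (d); [apply: (s'h (edge true 2 0)) | apply: (s'h (edge true 0 1))].
(* Going backwards from the source of the initial edge, [inH] forces this chain of Skolem terms. *)
pose tip n := iter n (fun a => Sk t inn [:: a]) (c (~~ d)).
have tipH n : exists y, edge d (tip n) y \in H.
  elim: n => [|n [y /inH[z zH]]]; first by exists (c d).
  exists (tip n); suff <- : z = tip n.+1 by [].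
  (* A tip is [c (~~ d)] or a Skolem term for [inn], hence neither [c d] nor a Skolem term for
     [out]. *)
  case: (invH _ _ zH) => [||-> //].
  - by case: n {zH} => [|n] //=; case: (d).
  - by case: n {zH} => [|n] //=; rewrite /inn /out; case: (d).
have tip_inj : injective tip.
  by elim=> [|m IHm] [|n] //= [/IHm->].
(* Pigeonhole: one more distinct tip than [H] has terms. *)
have : {subset map tip (iota 0 #|` terms H|.+1) <= terms H}.
  move=> _ /mapP[n _ ->]; have [y yH] := tipH n.
  apply/termsP; exists (edge d (tip n) y) => //=.
  by case: (d); rewrite !inE eqxx ?orbT.
move/uniq_leq_size; rewrite map_inj_uniq // iota_uniq size_map size_iota ltnn.
by move=> /(_ isT).
Qed.

Theorem theorem4 (le : rel term) (le_depth : depth_order le) :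
  exists R : {fset rule},
    [/\ wf_rules R,
        terminates le R
      & forall EQ : predicate, arity EQ = 2 -> EQ \notin preds R ->
        forall T : {fset tgd}, Sing EQ R T -> ~ terminates le (tgd_rules T)].
Proof.
exists loop_rules; split; first exact: wf_loop_rules.
  exact: loop_rules_terminates.
move=> EQ _ EQN T; apply: sing_loop_nonterminating.
apply: contraNneq EQN => ->.
apply/flatten_mapP; exists (TGD loop_tgd); last by rewrite inE.
by rewrite !inE eqxx.
Qed.
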